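(* Let $G$ be a simple connected graph with $N_0$ vertices and $E_0\ge1$ edges, and let $n\ge1$. The multiplicative degree-Kirchhoff indices of the hexagonal graphs $H_n(G)$ and $H_{n-1}(G)$ satisfy $$Kf'(H_n(G))=30Kf'(H_{n-1}(G))-16\cdot6^{n-1}E_0N_0+\left(\frac{416}{5}\cdot6^{2n-2}+\frac{64}{5}\cdot6^{n-1}\right)E_0^2-24\cdot6^{n-1}E_0.$$ Furthermore, $$Kf'(H_n(G))=30^nKf'(G)-4\cdot6^{n-1}(5^n-1)E_0N_0+\frac{16}{5}\cdot6^{n-1}(5^n-1)E_0^2+416\cdot30^{n-1}\left[\left(\frac65\right)^n-1\right]E_0^2-6\cdot6^{n-1}(5^n-1)E_0.$$
   Context: Graphs are finite, simple and connected. The hexagonal graph $H(G)$ of $G$ is obtained by replacing each edge $uv$ of $G$ by two internally disjoint $u$–$v$ paths, one of length $1$ (the edge $uv$ itself) and one of length $5$ (with 4 new internal vertices). Set $H_0(G)=G$ and $H_n(G)=H(H_{n-1}(G))$ for $n\ge1$. The multiplicative degree-Kirchhoff index of a connected graph $F$ is $Kf'(F)=\sum_{v<u}d_vd_ur_{vu}$, the sum over unordered pairs of distinct vertices, where $d_v$ is the degree of $v$ and $r_{vu}$ is the resistance distance between $v$ and $u$ (the effective resistance when every edge is a unit resistor). *)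

(* Defs.v *)
From mathcomp Require Import all_boot all_order all_algebra.
From mathcomp Require Import boolp classical_sets.

Set Implicit Arguments.
Unset Strict Implicit.
Unset Printing Implicit Defensive.

Import Order.TTheory GRing.Theory Num.Theory.

Local Open Scope ring_scope.

Record sgraph := SGraph {
  vert : finType;
  adj : rel vert;
  adj_sym : symmetric adj;
  adj_irr : irreflexive adj }.

Definition connected_graph (G : sgraph) : Prop :=
  (0 < #|vert G|)%N /\ forall x y : vert G, connect (@adj G) x y.

Definition degree (G : sgraph) (x : vert G) : nat := #|[set y | adj x y]|.

(* An arbitrary but fixed total order on the vertices, used only to choose one
   ordering of each unordered pair of distinct vertices. *)
Definition vlt (G : sgraph) (x y : vert G) : bool :=
  (enum_rank x < enum_rank y)%N.

(* An undirected edge xy is represented by its unique increasing pair. *)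
Definition edge (G : sgraph) : finType :=
  {p : vert G * vert G | vlt p.1 p.2 && adj p.1 p.2}.

Definition nb_vertices (G : sgraph) : nat := #|vert G|.
Definition nb_edges (G : sgraph) : nat := #|edge G|.

Section Hexagonal.
Variable G : sgraph.

(* [inr (d, i)] is the i-th of the four new vertices w_0, ..., w_3 on the path
   u - w_0 - w_1 - w_2 - w_3 - v of length 5 attached to the edge d = uv. *)
Definition hex_vert : finType := (vert G + edge G * 'I_4)%type.

Definition hex_attached (u : vert G) (d : edge G) (i : 'I_4) : bool :=
  ((i == 0%N :> nat) && (u == (val d).1))
  || ((i == 3%N :> nat) && (u == (val d).2)).

Definition hex_adj (a b : hex_vert) : bool :=
  match a, b with
  | inl u, inl v => adj u v
  | inl u, inr (d, i) => hex_attached u d i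
  | inr (d, i), inl u => hex_attached u d i
  | inr (d, i), inr (d', j) =>
      (d == d') && ((i.+1 == j :> nat) || (j.+1 == i :> nat))
  end.

Lemma hex_adj_sym : symmetric hex_adj.
Proof.
move=> [u|[d i]] [v|[d' j]] //=; first exact: adj_sym.
by rewrite eq_sym orbC.
Qed.

Lemma hex_adj_irr : irreflexive hex_adj.
Proof.
move=> [u|[d i]] /=; first exact: adj_irr.
by rewrite eqxx orbb (gtn_eqF (ltnSn i)).
Qed.

Definition hexagonal : sgraph := SGraph hex_adj_sym hex_adj_irr.

End Hexagonal.

Definition hex_iter (n : nat) (G : sgraph) : sgraph := iter n hexagonal G.

Section Resistance.
Variables (R : realFieldType) (G : sgraph).

(* Ohm's and Kirchhoff's laws with unit resistors: the potential [p] drives a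
   current p x - p y along each edge xy, and the net current leaving x is
   1 at the source u, -1 at the sink v and 0 elsewhere (0 everywhere when
   u = v). *)
Definition unit_flow_potential (u v : vert G) (p : vert G -> R) : Prop :=
  forall x, \sum_(y | adj x y) (p x - p y) = (x == u)%:R - (x == v)%:R.

(* Potential difference under a unit current.  In a connected graph such a
   potential exists and is unique up to an additive constant; the default
   value 0 only occurs when u and v lie in different components. *)
Definition resistance (u v : vert G) : R :=
  xget 0 [set r | exists2 p, unit_flow_potential u v p & r = p u - p v]%classic.

Definition mult_degree_Kirchhoff : R :=
  \sum_(v : vert G) \sum_(u : vert G | vlt v u)
    (degree v)%:R * (degree u)%:R * resistance v u.

End Resistance.

Arguments mult_degree_Kirchhoff R G : clear implicits.

(* Main.v *)
Require Import Defs.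
From mathcomp Require Import all_boot all_order all_algebra.
From mathcomp Require Import classical_sets.
From mathcomp Require Import ring.
From HB Require Import structures.

Set Implicit Arguments.
Unset Strict Implicit.
Unset Printing Implicit Defensive.

Import Order.TTheory GRing.Theory Num.Theory.

Local Open Scope ring_scope.

(** Write [L] for the graph Laplacian and call [k] a Green kernel of [G] when
    [L (k u)] is the unit charge at [u] minus a background [m] that is the same
    for all [u]. Three facts carry the proof.

    - A Green kernel determines everything. Since [L] is self-adjoint,
      [r u v = k u u - k u v - k v u + k v v] ([resistance_green]); summing
      against the degrees gives [Kf' = 2 E D - B] ([kirchhoff_green]), where
      [D] is the sum of [degree u * k u u] and [B] the sum of
      [degree u * degree v * k u v].

    - A Green kernel of [G] yields one of its hexagonal graph [hexagonal G]
      ([hex_green]). An edge in parallel with a path of length 5 conducts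
      [6/5], so interpolating [k] linearly along the paths in both variables
      and multiplying by [5/6] gives the right potential, except that a charge
      put inside a path appears moved to the two ends of that path. The Green
      function of the path with grounded ends ([edge_bump]) corrects this.

    - Summing that kernel gives [B' = 30 B + 40 E] and
      [D' = 5 D - 4/3 (N - 1) + 8 E]. Interpolation sends the degree
      weights of the new graph to 6 times the old ones, whence
      [5/6 * 6 ^ 2 = 30]. In [D'], interpolating the diagonal of [k] produces
      the resistances of the edges of [G], whose sum is [N - 1] by Foster's
      theorem ([foster]).

    Substituting in [Kf' = 2 E D - B], with [6 E] edges in [hexagonal G], gives
    [Kf' (hexagonal G) = 30 Kf' G - 16 E N + 96 E ^ 2 - 24 E]
    ([kirchhoff_hex]). The first formula is this one at [H_(n-1)], where
    [E_n = 6 ^ n E] and [N_n = N + 4/5 (6 ^ n - 1) E], and the second follows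
    from it by induction on [n]. Connectedness provides the first Green
    kernel ([green_kernel_exists]). *)

(** * Sums over pairs of vertices and over edges *)

(** The order [vlt] only picks one of the two orderings of each pair; this
    serves both for edges and for the pairs of distinct vertices in the
    Kirchhoff index. *)
Lemma sum_rel_increasing (V : nmodType) (G : sgraph) (e : rel (vert G))
    (F : vert G -> vert G -> V) (esym : symmetric e) (eirr : irreflexive e) :
  \sum_x \sum_(y | e x y) F x y =
  \sum_x \sum_(y | vlt x y && e x y) (F x y + F y x).
Proof.
transitivity (\sum_x (\sum_(y | vlt x y && e x y) F x y
                    + \sum_(y | vlt y x && e y x) F x y)).
  apply: eq_bigr => x _; rewrite (bigID (vlt x)) /=; congr (_ + _).
    by apply: eq_bigl => y; rewrite andbC.
  apply: eq_bigl => y; rewrite [e y x]esym /vlt -leqNgt leq_eqVlt.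
  have [<-|_] := eqVneq y x; first by rewrite eirr andbF.
  by case: eqVneq => [/val_inj/enum_rank_inj->|_]; rewrite ?eirr ?andbF // andbC.
rewrite big_split /= [X in _ + X](exchange_big_dep predT) //= -big_split /=.
by apply: eq_bigr => x _; rewrite big_split.
Qed.

Lemma sum_edge (V : nmodType) (G : sgraph) (F : vert G -> vert G -> V) :
  \sum_(d : edge G) (F (val d).1 (val d).2 + F (val d).2 (val d).1) =
  \sum_x \sum_(y | adj x y) F x y.
Proof.
rewrite (sum_rel_increasing _ (@adj_sym G) (@adj_irr G)) pair_big_dep /=.
rewrite (reindex_omap (val : edge G -> _) insub) => [|p Pp]; last first.
  by rewrite insubT.
by apply: eq_bigl => -[p Pp] /=; rewrite insubT Pp /= eqxx.
Qed.

(** The neighbours of [u] reached through the edges stored with [u] first and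
    those stored with [u] second. It comes from the global double count by
    keeping only the terms at [u]. *)
Lemma sum_neighbours_edge (V : nmodType) (G : sgraph) (F : vert G -> V) (u : vert G) :
  \sum_(d : edge G | u == (val d).1) F (val d).2 +
  \sum_(d : edge G | u == (val d).2) F (val d).1 =
  \sum_(v | adj u v) F v.
Proof.
rewrite [X in X + _]big_mkcond [X in _ + X]big_mkcond -big_split /=.
rewrite (sum_edge (fun x y => if u == x then F y else 0)).
rewrite (bigD1 u) //= eqxx [X in _ + X]big1 ?addr0 // => x /negPf nxu.
by rewrite big1 // => y _; rewrite eq_sym nxu.
Qed.

(** * The Laplacian *)

Definition laplacian {R : realFieldType} {G : sgraph} (f : vert G -> R)
    (x : vert G) : R := \sum_(y | adj x y) (f x - f y).

Section Laplacian.
Variables (R : realFieldType) (G : sgraph).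
Implicit Types f g : vert G -> R.

Lemma eq_laplacian f g : f =1 g -> laplacian f =1 laplacian g.
Proof. by move=> fg x; apply: eq_bigr => y _; rewrite !fg. Qed.

Lemma laplacianD f g x :
  laplacian (fun y => f y + g y) x = laplacian f x + laplacian g x.
Proof. by rewrite -big_split /=; apply: eq_bigr => y _; ring. Qed.

Lemma laplacianZ a f x : laplacian (fun y => a * f y) x = a * laplacian f x.
Proof. by rewrite mulr_sumr; apply: eq_bigr => y _; ring. Qed.

Lemma laplacianB f g x :
  laplacian (fun y => f y - g y) x = laplacian f x - laplacian g x.
Proof. by rewrite -sumrB; apply: eq_bigr => y _; ring. Qed.

(** Summation by parts. Self-adjointness, conservation of charge and the
    rigidity of harmonic functions all follow from it. *)
Lemma dirichlet_form f g :
  \sum_x f x * laplacian g x =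
  \sum_(d : edge G) (f (val d).1 - f (val d).2) * (g (val d).1 - g (val d).2).
Proof.
transitivity (\sum_x \sum_(y | adj x y) f x * (g x - g y)).
  by apply: eq_bigr => x _; rewrite mulr_sumr.
by rewrite -sum_edge; apply: eq_bigr => d _; ring.
Qed.

Lemma laplacian_selfadjoint f g :
  \sum_x f x * laplacian g x = \sum_x g x * laplacian f x.
Proof. by rewrite !dirichlet_form; apply: eq_bigr => d _; rewrite mulrC. Qed.

Lemma sum_laplacian f : \sum_x laplacian f x = 0.
Proof.
under eq_bigr do rewrite -[laplacian _ _]mul1r.
rewrite (dirichlet_form (fun=> 1)) big1 // => d _; ring.
Qed.

(** A harmonic function has energy zero, and the energy is a sum of squares of
    its increments along edges. *)
Lemma harmonic_const f (hG : connected_graph G) :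
  laplacian f =1 (fun=> 0) -> forall x y, f x = f y.
Proof.
move=> harm.
have: \sum_x f x * laplacian f x = 0 by apply: big1 => x _; rewrite harm mulr0.
rewrite dirichlet_form => /psumr_eq0P E0.
have sq0 (d : edge G) : f (val d).1 = f (val d).2.
  have /eqP := E0 (fun d _ => sqr_ge0 (f (val d).1 - f (val d).2)) d isT.
  by rewrite mulf_eq0 orbb subr_eq0 => /eqP.
have adj_eq x y : adj x y -> f x = f y.
  move=> xy; have [lt_xy|] := boolP (vlt x y).
    have p : vlt (x, y).1 (x, y).2 && adj (x, y).1 (x, y).2 by rewrite lt_xy.
    exact: sq0 (exist _ (x, y) p).
  rewrite /vlt -leqNgt leq_eqVlt => /orP[/eqP/val_inj/enum_rank_inj->//|lt_yx].
  have p : vlt (y, x).1 (y, x).2 && adj (y, x).1 (y, x).2.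
    by rewrite /vlt lt_yx adj_sym.
  by have /esym := sq0 (exist _ (y, x) p).
move=> x y; have /connectP[s] := hG.2 x y.
by elim: s x => [x _ -> //|z s IH x /= /andP[/adj_eq-> /IH]]; apply.
Qed.

Lemma sum_mul_dipole (x y : vert G) (f : vert G -> R) :
  \sum_z f z * ((z == x)%:R - (z == y)%:R) = f x - f y.
Proof.
have pick u : \sum_z f z * (z == u)%:R = f u.
  rewrite (bigD1 u) //= eqxx mulr1 big1 ?addr0 // => z /negPf->.
  by rewrite mulr0.
by under eq_bigr do rewrite mulrBr; rewrite sumrB !pick.
Qed.

End Laplacian.

(** * Green kernels, resistances and the Kirchhoff index *)

(** The background [m] is arbitrary rather than uniform because the kernel
    built for the hexagonal graph has its background on the old vertices. *)
Definition green_kernel {R : realFieldType} {G : sgraph} (m : vert G -> R)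
    (k : vert G -> vert G -> R) : Prop :=
  forall u x, laplacian (k u) x = (x == u)%:R - m x.

(** Adding the total sum to the Laplacian removes its kernel (the constants on
    a connected graph), so [phi] below is invertible; solving
    [phi (k u) = delta_u] gives a Green kernel with uniform background. *)
Lemma green_kernel_exists (R : realFieldType) (G : sgraph)
    (hG : connected_graph G) :
  exists m : vert G -> R, exists k, green_kernel m k.
Proof.
pose T := {ffun vert G -> R^o}.
pose phi (f : T) : T := [ffun x => laplacian f x + \sum_y f y].
have philin : linear phi.
  move=> a f g; apply/ffunP => x; rewrite !ffunE.
  rewrite (eq_laplacian (g := fun y => a * f y + g y)); last first.
    by move=> y; rewrite !ffunE.
  rewrite laplacianD laplacianZ; under eq_bigr do rewrite !ffunE.
  rewrite big_split /= -scaler_sumr /GRing.scale /=; ring.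
pose Lphi := GRing.isLinear.Build R T T *:%R phi philin.
pose phiL : {linear T -> T} := HB.pack phi Lphi.
have nz : (#|vert G|%:R : R) != 0 by rewrite pnatr_eq0 -lt0n; case: hG.
have phi_inj0 h : phi h = 0 -> h = 0.
  move=> /ffunP phi0.
  have phi0' x : laplacian h x + \sum_y h y = 0.
    by have := phi0 x; rewrite !ffunE.
  have sum0 : \sum_y h y = 0.
    have : \sum_x (laplacian h x + \sum_y h y) = 0 by apply: big1.
    rewrite big_split /= sum_laplacian add0r sumr_const -mulr_natr => /eqP.
    by rewrite mulf_eq0 (negPf nz) orbF => /eqP.
  have hc x y : h x = h y.
    by apply: (harmonic_const (f := h) hG) => z; rewrite -(phi0' z) sum0 addr0.
  apply/ffunP => x; rewrite ffunE; apply/eqP.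
  move: sum0; under eq_bigr do rewrite (hc _ x).
  by rewrite sumr_const -mulr_natr => /eqP; rewrite mulf_eq0 (negPf nz) orbF.
have ker0 : lker (linfun phiL) == 0%VS.
  apply/lker0P => f g; rewrite !lfunE => fg; apply/subr0_eq/phi_inj0.
  by rewrite -[phi _]/(phiL _) linearB fg subrr.
pose k u : T := ((linfun phiL)^-1)%VF [ffun x => (x == u)%:R].
have kE u x : laplacian (k u) x + \sum_y k u y = (x == u)%:R.
  have /ffunP/(_ x) := lker0_lfunVK ker0 [ffun x => (x == u)%:R].
  by rewrite lfunE /= !ffunE.
exists (fun=> #|vert G|%:R^-1), (fun u => k u) => u x.
rewrite -(kE u x).
suff -> : \sum_y k u y = #|vert G|%:R^-1 by ring.
have : \sum_x (laplacian (k u) x + \sum_y k u y) = 1.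
  under eq_bigr do rewrite kE.
  by rewrite (bigD1 u) //= eqxx big1 ?addr0 // => y /negPf->.
rewrite big_split /= sum_laplacian add0r sumr_const => sumk.
by apply: (mulfI nz); rewrite mulr_natl sumk mulfV.
Qed.

Section Resistance.
Variables (R : realFieldType) (G : sgraph).
Variables (m : vert G -> R) (k : vert G -> vert G -> R).
Hypothesis greenk : green_kernel m k.

(** [k u - k v] is a potential for the unit flow from [u] to [v]. Any other
    potential [p] has the same drop: by reciprocity, [p u - p v] is the pairing
    of [p] with the Laplacian of [k u - k v], hence of [k u - k v] with the
    Laplacian of [p], which is again the dipole at [u] and [v]. *)
Lemma resistance_green u v :
  resistance R u v = k u u - k u v - k v u + k v v.
Proof.
have lapB x : laplacian (fun x => k u x - k v x) x = (x == u)%:R - (x == v)%:R.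
  by rewrite laplacianB !greenk; ring.
rewrite /resistance; apply: xget_unique => [|_ [p pP ->]] /=.
  by exists (fun x => k u x - k v x) => //; ring.
rewrite -sum_mul_dipole.
under eq_bigr do rewrite -lapB.
rewrite laplacian_selfadjoint.
under eq_bigr => x do rewrite /laplacian (pP x).
by rewrite sum_mul_dipole; ring.
Qed.

Lemma kirchhoff_green :
  mult_degree_Kirchhoff R G =
  (\sum_(u : vert G) (degree u)%:R) * (\sum_u (degree u)%:R * k u u)
  - \sum_u \sum_v (degree u)%:R * (degree v)%:R * k u v.
Proof.
pose F (u v : vert G) : R := (degree u)%:R * (degree v)%:R * resistance R u v.
have Fsym u v : F u v = F v u by rewrite /F !resistance_green; ring.
have F0 u : F u u = 0 by rewrite /F resistance_green; ring.
have dbl : \sum_u \sum_v F u v = 2 * mult_degree_Kirchhoff R G.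
  transitivity (\sum_u \sum_(v | u != v) F u v).
    apply: eq_bigr => u _; rewrite (bigD1 u) //= F0 add0r.
    by apply: eq_bigl => v; rewrite eq_sym.
  have nsym : symmetric (fun u v : vert G => u != v).
    by move=> u v; rewrite eq_sym.
  have nirr : irreflexive (fun u v : vert G => u != v).
    by move=> u; rewrite eqxx.
  rewrite (sum_rel_increasing F nsym nirr) mulr_sumr.
  apply: eq_bigr => u _; rewrite mulr_sumr; apply: eq_big => [v|v _].
    by rewrite /vlt; have [->|_] := eqVneq u v; rewrite ?ltnn ?andbT.
  by rewrite [F v u]Fsym mulr2n mulrDl mul1r.
apply: (@mulfI _ 2); first by rewrite pnatr_eq0.
rewrite -dbl.
transitivity (\sum_u \sum_v ((degree u)%:R * k u u * (degree v)%:R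
   + (degree u)%:R * ((degree v)%:R * k v v)
   - (degree u)%:R * (degree v)%:R * k u v
   - (degree v)%:R * (degree u)%:R * k v u)).
  by apply: eq_bigr => u _; apply: eq_bigr => v _; rewrite /F resistance_green; ring.
under eq_bigr do rewrite !sumrB big_split /= -!mulr_sumr.
rewrite !sumrB big_split /= -!mulr_suml.
rewrite [X in _ - X](exchange_big) /=; ring.
Qed.

(** The total current injected by any potential is zero. *)
Lemma green_mass (x0 : vert G) : \sum_x m x = 1.
Proof.
have := sum_laplacian (k x0).
under eq_bigr do rewrite greenk.
rewrite sumrB (bigD1 x0) //= eqxx big1 ?addr0 => [/eqP|y /negPf->//].
by rewrite subr_eq0 => /eqP.
Qed.

(** Foster's theorem: summed over the edges, the resistances collect the
    values [L (k x) x = 1 - m x], and [m] has total mass 1. *)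
Lemma foster (x0 : vert G) :
  \sum_(d : edge G) resistance R (val d).1 (val d).2 = (nb_vertices G)%:R - 1.
Proof.
transitivity (\sum_(d : edge G)
   ((k (val d).1 (val d).1 - k (val d).1 (val d).2)
  + (k (val d).2 (val d).2 - k (val d).2 (val d).1))).
  by apply: eq_bigr => d _; rewrite resistance_green; ring.
rewrite (sum_edge (fun x y => k x x - k x y)).
transitivity (\sum_x (1 - m x)).
  by apply: eq_bigr => x _; rewrite -/(laplacian _ _) greenk eqxx.
by rewrite sumrB (green_mass x0) sumr_const.
Qed.

End Resistance.

Lemma sum_degree_mul (R : realFieldType) (G : sgraph) (f : vert G -> R) :
  \sum_u (degree u)%:R * f u =
  \sum_(d : edge G) (f (val d).1 + f (val d).2).
Proof.
rewrite (sum_edge (fun x _ => f x)); apply: eq_bigr => u _.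
rewrite mulr_natl -sumr_const; apply: eq_bigl => v.
by rewrite inE.
Qed.

Lemma handshake (R : realFieldType) (G : sgraph) :
  \sum_(u : vert G) (degree u)%:R = 2 * (nb_edges G)%:R :> R.
Proof.
under eq_bigr do rewrite -[_%:R]mulr1.
by rewrite (sum_degree_mul (fun=> 1)) sumr_const mulr_natr.
Qed.

(** * Neighbourhoods and degrees in the hexagonal graph *)

Section Hex.
Variables (R : realFieldType) (G : sgraph).
Local Notation H := (hexagonal G).

(** The points 0, ..., 5 of the path of length 5 attached to [d], ends
    included (every index from 5 on gives the second end), so that the two
    neighbours of an internal vertex are described without cases. *)
Definition path_pt (d : edge G) (j : nat) : vert H :=
  match j with
  | 0 => inl (val d).1
  | j'.+1 => if (j' < 4)%N then inr (d, inord j') else inl (val d).2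
  end.

Lemma path_ptE (d : edge G) (i : 'I_4) : path_pt d i.+1 = inr (d, i).
Proof. by rewrite /= ltn_ord inord_val. Qed.

Lemma big_ord4 (V : nmodType) (F : 'I_4 -> V) :
  \sum_i F i = F (inord 0) + F (inord 1) + F (inord 2) + F (inord 3).
Proof.
rewrite !big_ord_recl big_ord0 addr0 !addrA.
by do !congr (_ + _); congr F; apply: val_inj; rewrite /= inordK.
Qed.

Lemma sum_prod_ord4 (V : nmodType) (T : finType) (P : pred (T * 'I_4))
    (F : T * 'I_4 -> V) :
  \sum_(p | P p) F p =
  \sum_t ((if P (t, inord 0) then F (t, inord 0) else 0)
        + (if P (t, inord 1) then F (t, inord 1) else 0)
        + (if P (t, inord 2) then F (t, inord 2) else 0)
        + (if P (t, inord 3) then F (t, inord 3) else 0)).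
Proof.
transitivity (\sum_t \sum_(i | P (t, i)) F (t, i)).
  by rewrite pair_big_dep; apply: eq_big => -[].
by apply: eq_bigr => t _; rewrite big_mkcond big_ord4.
Qed.

Lemma sum_neighbours_old (V : nmodType) (u : vert G) (F : vert H -> V) :
  \sum_(b : vert H | @adj H (inl u) b) F b =
  \sum_(v | adj u v) F (inl v)
  + (\sum_(d : edge G | u == (val d).1) F (path_pt d 1)
     + \sum_(d : edge G | u == (val d).2) F (path_pt d 4)).
Proof.
rewrite big_sumType /=; congr (_ + _).
rewrite sum_prod_ord4.
rewrite [X in _ = X + _]big_mkcond [X in _ = _ + X]big_mkcond -big_split /=.
apply: eq_bigr => d _; rewrite /hex_attached !inordK //=.
by rewrite orbF !addr0.
Qed.

Lemma sum_neighbours_new (V : nmodType) (d : edge G) (i : 'I_4) (F : vert H -> V) :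
  \sum_(b : vert H | @adj H (inr (d, i)) b) F b =
  F (path_pt d i) + F (path_pt d i.+2).
Proof.
rewrite big_sumType /=.
rewrite sum_prod_ord4 (bigD1 d) //= [X in _ + (_ + X)]big1 => [|e /negPf ne_ed].
2: by rewrite eq_sym ne_ed !addr0.
rewrite eqxx /= !inordK // addr0.
have pick1 u : \sum_(v | v == u) F (inl v) = F (inl u) by rewrite big_pred1_eq.
case: i => -[|[|[|[|//]]]] lt_i; rewrite /hex_attached /=.
- under eq_bigl do rewrite orbF.
  by rewrite pick1 !addr0 add0r.
- by rewrite big_pred0_eq !addr0 !add0r.
- by rewrite big_pred0_eq !addr0 !add0r.
- by rewrite pick1 !addr0 !add0r addrC.
Qed.

(** A degree is a sum over neighbours, so that the descriptions of the
    neighbourhoods as sums apply to degrees as well. *)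
Lemma sum_adj1 (F : sgraph) (u : vert F) :
  \sum_(v | adj u v) 1 = (degree u)%:R :> rat.
Proof. by rewrite -(sumr_const _ 1); apply: eq_bigl => v; rewrite inE. Qed.

Lemma degree_old (u : vert G) : @degree H (inl u) = (2 * degree u)%N.
Proof.
apply/eqP; rewrite -(eqr_nat rat) natrM -!sum_adj1 sum_neighbours_old.
by rewrite (sum_neighbours_edge (fun=> 1)); apply/eqP; ring.
Qed.

Lemma degree_new d i : @degree H (inr (d, i)) = 2.
Proof. by apply/eqP; rewrite -(eqr_nat rat) -sum_adj1 sum_neighbours_new. Qed.

Lemma nb_vertices_hex : nb_vertices H = (nb_vertices G + 4 * nb_edges G)%N.
Proof. by rewrite /nb_vertices card_sum card_prod card_ord mulnC. Qed.

Lemma sum_vert_hex (V : nmodType) (F : vert H -> V) :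
  \sum_a F a = \sum_u F (inl u) + \sum_(d : edge G)
     (F (path_pt d 1) + F (path_pt d 2) + F (path_pt d 3) + F (path_pt d 4)).
Proof.
rewrite big_sumType /=; congr (_ + _).
by rewrite sum_prod_ord4.
Qed.

(** * Potentials on the hexagonal graph *)

(** No current is injected inside the attached paths, so a potential is affine
    along them; [inr (d, i)] is the point [i.+1] of its path. *)
Definition harmonic_ext (f : vert G -> R) (a : vert H) : R :=
  match a with
  | inl u => f u
  | inr (d, i) => (1 - i.+1%:R / 5) * f (val d).1 + i.+1%:R / 5 * f (val d).2
  end.

Lemma harmonic_ext_path f d j : (j <= 5)%N ->
  harmonic_ext f (path_pt d j) = (1 - j%:R / 5) * f (val d).1 + j%:R / 5 * f (val d).2.
Proof.
case: j => [|j] /=; first by move=> _; ring.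
rewrite ltnS leq_eqVlt => /orP[/eqP->|lt_j4] /=; first by field.
by rewrite lt_j4 /= inordK.
Qed.

(** An old edge carries the current of the edge itself and one fifth of it
    through the attached path. *)
Lemma laplacian_ext_old f u : laplacian (harmonic_ext f) (inl u : vert H) = 6 / 5 * laplacian f u.
Proof.
rewrite /laplacian sum_neighbours_old.
(* The current entering the attached path from [u] towards the other end [v]. *)
pose g v := (f u - f v) / 5.
rewrite (eq_bigr (fun d => g (val d).2)) => [|d /eqP ud]; last first.
  by rewrite harmonic_ext_path // -ud /g /=; field.
rewrite [X in _ + (_ + X)](eq_bigr (fun d => g (val d).1)) => [|d /eqP ud]; last first.
  by rewrite harmonic_ext_path // -ud /g /=; field.
by rewrite sum_neighbours_edge -big_split mulr_sumr; apply: eq_bigr => v _; rewrite /g /=; field.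
Qed.

Lemma laplacian_new (f : vert H -> R) d (i : 'I_4) :
  laplacian f (inr (d, i) : vert H) =
  2 * f (path_pt d i.+1) - f (path_pt d i) - f (path_pt d i.+2).
Proof. by rewrite /laplacian sum_neighbours_new path_ptE; ring. Qed.

Lemma laplacian_ext_new f d (i : 'I_4) : laplacian (harmonic_ext f) (inr (d, i) : vert H) = 0.
Proof.
have lt_i := ltn_ord i; have le5 : (i <= 5)%N := leqW (ltnW lt_i).
rewrite laplacian_new !harmonic_ext_path ?(leqW lt_i) //.
by rewrite -[i.+2]addn2 -[i.+1]addn1 !natrD; field.
Qed.

(** The Green function of the path [0, ..., 5] with both ends grounded. *)
Definition path_green (i j : nat) : R := (minn i j)%:R * (5 - (maxn i j)%:R) / 5.

Definition edge_bump (a b : vert H) : R :=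
  match a, b with
  | inr (d, i), inr (e, j) => if d == e then path_green i.+1 j.+1 else 0
  | _, _ => 0
  end.

Lemma edge_bump_new_path d (i : 'I_4) e j : (j <= 5)%N ->
  edge_bump (inr (d, i)) (path_pt e j) = if d == e then path_green i.+1 j else 0.
Proof.
case: j => [|j] /=.
  by rewrite /path_green minn0 !mul0r if_same.
rewrite ltnS leq_eqVlt => /orP[/eqP->|lt_j4] /=.
  rewrite /path_green (maxn_idPr _) ?subrr ?mulr0 ?mul0r ?if_same //.
  by apply: leq_trans (ltn_ord i) _.
by rewrite lt_j4 /= inordK.
Qed.

(** The grounded ends absorb a unit charge placed at the point [i.+1] in the
    proportions [1 - i.+1 / 5] and [i.+1 / 5], which are the weights of
    [harmonic_ext]: this is the discrepancy that [edge_bump] must repair. *)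
Lemma laplacian_edge_bump (d : edge G) i (b : vert H) :
  laplacian (edge_bump (inr (d, i))) b =
  (b == inr (d, i))%:R - harmonic_ext (fun u => (b == inl u)%:R) (inr (d, i)).
Proof.
case: b => [u|[e j]].
  rewrite /laplacian sum_neighbours_old [X in X + _]big1 ?add0r;
    last by move=> v _; exact: subrr.
  under eq_bigr do rewrite edge_bump_new_path // sub0r.
  under [X in _ + X]eq_bigr do rewrite edge_bump_new_path // sub0r.
  have pick (P : pred (edge G)) (c : R) :
      \sum_(e | P e) - (if d == e then c else 0) = - c * (P d)%:R.
    rewrite big_mkcond (bigD1 d) //= eqxx big1 ?addr0 => [|e /negPf ne_ed].
      by case: (P d); rewrite ?mulr1 ?mulr0.
    by rewrite eq_sym ne_ed oppr0 if_same.
  rewrite !pick /path_green.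
  have inlE x : (inl u == inl x :> vert H) = (u == x) by [].
  rewrite /= !inlE.
  by case: i => -[|[|[|[|//]]]] lt_i /=; rewrite /minn /maxn /=; field.
have lt_j := ltn_ord j; have le5 : (j <= 5)%N := leqW (ltnW lt_j).
rewrite laplacian_new !edge_bump_new_path ?(leqW lt_j) //.
rewrite /= !mulr0 addr0 subr0.
have -> : (inr (e, j) == inr (d, i) :> vert H) = (d == e) && (i == j).
  by apply/eqP/andP => [[-> ->]|[/eqP-> /eqP->]].
case: (d == e); rewrite /= ?andbF ?mulr0 ?subr0 //.
case: i j {lt_j le5} => -[|[|[|[|//]]]] lt_i [] [|[|[|[|//]]]] lt_j.
all: by rewrite /path_green /eq_op /minn /maxn /=; field.
Qed.

End Hex.

(** * Degree-weighted sums *)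

Section DegreeSums.
Variables (R : realFieldType) (G : sgraph).
Local Notation H := (hexagonal G).

Lemma sum_degree_hex (F : vert H -> R) :
  \sum_a (degree a)%:R * F a =
  2 * (\sum_(u : vert G) (degree u)%:R * F (inl u) + \sum_(d : edge G)
     (F (path_pt d 1) + F (path_pt d 2) + F (path_pt d 3) + F (path_pt d 4))).
Proof.
rewrite sum_vert_hex mulrDr !mulr_sumr; congr (_ + _); apply: eq_bigr.
  by move=> u _; rewrite degree_old natrM mulrA.
by move=> d _; rewrite !degree_new; ring.
Qed.

(** The old copy of [u] has degree [2 * degree u]. Each edge at [u] contributes
    four internal vertices of degree 2 whose weights at [u] are 1/5, ..., 4/5,
    that is 4 in all: together [6 * degree u]. *)
Lemma sum_degree_ext (f : vert G -> R) :
  \sum_(a : vert H) (degree a)%:R * harmonic_ext f a =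
  6 * \sum_u (degree u)%:R * f u.
Proof.
rewrite sum_degree_hex.
under [X in _ + X]eq_bigr do rewrite !harmonic_ext_path //.
rewrite (eq_bigr (fun d => 2 * (f (val d).1 + f (val d).2))) => [|d _]; last by field.
by rewrite -mulr_sumr -sum_degree_mul; ring.
Qed.

End DegreeSums.

Lemma nb_edges_hex (G : sgraph) :
  nb_edges (hexagonal G) = (6 * nb_edges G)%N.
Proof.
have two_neq0 : (2 : rat) != 0 by [].
apply/eqP; rewrite -(eqr_nat rat) natrM; apply/eqP/(mulfI two_neq0).
rewrite -handshake; under eq_bigr do rewrite -[(degree _)%:R]mulr1.
rewrite (sum_degree_hex (fun=> 1)); under eq_bigr do rewrite mulr1.
by rewrite handshake sumr_const -mulr_natr /nb_edges; ring.
Qed.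

(** * The Green kernel of the hexagonal graph *)

Section HexKernel.
Variables (R : realFieldType) (G : sgraph).
Local Notation H := (hexagonal G).
Variables (m : vert G -> R) (k : vert G -> vert G -> R).
Hypothesis greenk : green_kernel m k.

Definition hex_mass (a : vert H) : R := if a is inl u then m u else 0.

Definition hex_kernel (a b : vert H) : R :=
  5 / 6 * harmonic_ext (fun u => harmonic_ext (k u) b) a + edge_bump R a b.

Lemma laplacian_ext_green u (b : vert H) :
  laplacian (fun b => 5 / 6 * harmonic_ext (k u) b) b = (b == inl u)%:R - hex_mass b.
Proof.
rewrite laplacianZ; case: b => [v|[e j]].
  by rewrite laplacian_ext_old greenk /= -[inl v == inl u]/(v == u); field.
by rewrite laplacian_ext_new mulr0 /= subr0.
Qed.

(** The interpolated part has charge at the projection of [a] on the ends of its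
    path, and [edge_bump] moves that charge to [a]; the weights sum to 1, so
    the background is the same for all [a]. *)
Lemma hex_green : green_kernel hex_mass hex_kernel.
Proof.
move=> [u|[d i]] b; rewrite /hex_kernel /=.
  rewrite (eq_laplacian (g := fun b => 5 / 6 * harmonic_ext (k u) b)) => [|c].
    exact: laplacian_ext_green.
  by rewrite addr0.
set t := _ / 5.
rewrite (eq_laplacian (g := fun b => (1 - t) * (5 / 6 * harmonic_ext (k (val d).1) b)
   + (t * (5 / 6 * harmonic_ext (k (val d).2) b) + edge_bump R (inr (d, i)) b))) => [|c].
  rewrite !(laplacianD, laplacianZ (1 - t), laplacianZ t) !laplacian_ext_green.
  rewrite laplacian_edge_bump /= -/t.
  move: (b == inl _) (b == inl _) (b == inr _) (hex_mass b) => p q r s.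
  by ring.
by rewrite -/t /=; ring.
Qed.

Lemma edge_bump_path (d e : edge G) i j : (0 < i <= 4)%N -> (j <= 5)%N ->
  edge_bump R (path_pt d i) (path_pt e j) = if d == e then path_green R i j else 0.
Proof.
by case: i => // i /= lt_i4 le_j5; rewrite lt_i4 edge_bump_new_path // inordK.
Qed.

Lemma sum_degree_edge_bump_at (d : edge G) i : (0 < i <= 4)%N ->
  \sum_(b : vert H) (degree b)%:R * edge_bump R (path_pt d i) b =
  i%:R * (5 - i%:R).
Proof.
move=> le_i; rewrite sum_degree_hex big1 ?add0r => [|u _]; last first.
  by case: i le_i => // i /= ->; rewrite mulr0.
rewrite (bigD1 d) // [X in 2 * (_ + X)]big1 ?addr0 => [|e /andP[_]].
  rewrite !edge_bump_path // eqxx /path_green.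
  by case: i le_i => // -[|[|[|[|//]]]] _; rewrite /minn /maxn /=; field.
by rewrite eq_sym => /negPf ne_de; rewrite !edge_bump_path // ne_de !addr0.
Qed.

Lemma sum_degree_edge_bump :
  \sum_(a : vert H) \sum_(b : vert H)
    (degree a)%:R * (degree b)%:R * edge_bump R a b = 40 * (nb_edges G)%:R.
Proof.
pose F a := \sum_(b : vert H) (degree b)%:R * edge_bump R a b.
transitivity (\sum_a (degree a)%:R * F a).
  by apply: eq_bigr => a _; rewrite mulr_sumr; apply: eq_bigr => b _; ring.
rewrite sum_degree_hex big1 ?add0r => [|u _]; last first.
  by rewrite /F big1 ?mulr0 // => b _; rewrite mulr0.
(* [20 = 4 + 6 + 6 + 4], the values of [i * (5 - i)]. *)
rewrite (eq_bigr (fun=> 20)) => [|d _].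
  by rewrite sumr_const -mulr_natr /nb_edges; ring.
by rewrite /F !sum_degree_edge_bump_at //; ring.
Qed.

(** At the point of parameter [t] of an edge [uv], interpolating [k] in both
    variables gives [(1 - t) k u u + t k v v - t (1 - t) r u v]. Over
    [t = 1/5, ..., 4/5] the weights add up to 2, 2 and 4/5, and Foster's theorem
    sums the resistances. The grounded path contributes 4 per edge, the sum of
    [i (5 - i) / 5]. *)
Lemma sum_degree_hex_kernel_diag (x0 : vert G) :
  \sum_(a : vert H) (degree a)%:R * hex_kernel a a =
  5 * (\sum_u (degree u)%:R * k u u) - 4 / 3 * ((nb_vertices G)%:R - 1)
  + 8 * (nb_edges G)%:R.
Proof.
rewrite sum_degree_hex /hex_kernel.
pose D (d : edge G) := k (val d).1 (val d).1 + k (val d).2 (val d).2.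
rewrite [X in _ + X](eq_bigr (fun d => 5 / 3 * D d
   - 2 / 3 * resistance R (val d).1 (val d).2 + 4)) => [|d _]; last first.
  rewrite !edge_bump_path // !harmonic_ext_path // eqxx (resistance_green greenk) /D.
  by rewrite /path_green /minn /maxn /=; field.
rewrite !big_split /= sumrN -!mulr_sumr (foster greenk x0) sumr_const.
rewrite -(sum_degree_mul (fun u => k u u)) -mulr_natr /nb_edges.
under eq_bigr do rewrite addr0 mulrCA.
by rewrite -mulr_sumr; field.
Qed.

(** Each of the two interpolations contributes a factor 6 by
    [sum_degree_ext]. *)
Lemma sum_degree_hex_kernel :
  \sum_(a : vert H) \sum_(b : vert H) (degree a)%:R * (degree b)%:R * hex_kernel a b =
  30 * (\sum_u \sum_v (degree u)%:R * (degree v)%:R * k u v)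
  + 40 * (nb_edges G)%:R.
Proof.
rewrite -sum_degree_edge_bump.
have -> : 30 * (\sum_u \sum_v (degree u)%:R * (degree v)%:R * k u v) =
   \sum_(a : vert H) \sum_(b : vert H) (degree a)%:R * (degree b)%:R *
      (5 / 6 * harmonic_ext (fun u => harmonic_ext (k u) b) a).
  rewrite [RHS]exchange_big /=.
  transitivity (5 * \sum_(b : vert H) (degree b)%:R *
       harmonic_ext (fun v => \sum_u (degree u)%:R * k u v) b).
    rewrite sum_degree_ext mulrA -natrM exchange_big; congr (_ * _).
    by apply: eq_bigr => v _; rewrite mulr_sumr; apply: eq_bigr => u _; ring.
  rewrite mulr_sumr; apply: eq_bigr => b _.
  transitivity (5 / 6 * (degree b)%:R *
    (\sum_(a : vert H) (degree a)%:R * harmonic_ext (fun u => harmonic_ext (k u) b) a)).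
    rewrite sum_degree_ext.
    have -> : harmonic_ext (fun v => \sum_u (degree u)%:R * k u v) b =
       \sum_u (degree u)%:R * harmonic_ext (k u) b.
      case: b => [//|[e j]] /=; rewrite !mulr_sumr -big_split /=.
      by apply: eq_bigr => u _; ring.
    by field.
  by rewrite mulr_sumr; apply: eq_bigr => a _; ring.
rewrite -big_split; apply: eq_bigr => a _; rewrite -big_split.
by apply: eq_bigr => b _; rewrite /= -mulrDr.
Qed.

Lemma kirchhoff_hex (x0 : vert G) :
  mult_degree_Kirchhoff R H =
  30 * mult_degree_Kirchhoff R G - 16 * (nb_edges G)%:R * (nb_vertices G)%:R
  + 96 * (nb_edges G)%:R ^+ 2 - 24 * (nb_edges G)%:R.
Proof.
rewrite (kirchhoff_green hex_green) (kirchhoff_green greenk).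
rewrite (sum_degree_hex_kernel_diag x0) sum_degree_hex_kernel !handshake.
by rewrite nb_edges_hex natrM; field.
Qed.

End HexKernel.

(** * Iterated hexagonal graphs *)

Section Iterate.
Variables (R : realFieldType) (G : sgraph).
Hypothesis hG : connected_graph G.

Lemma hex_iter_green n : exists m : vert (hex_iter n G) -> R, exists k, green_kernel m k.
Proof.
elim: n => [|n [m [k greenk]]]; first exact: green_kernel_exists.
by exists (hex_mass m), (hex_kernel k); apply: hex_green.
Qed.

Lemma hex_iter_vert n : vert (hex_iter n G).
Proof.
elim: n => [|n x]; last exact: inl x.
by have /card_gt0P/sigW[] := hG.1.
Qed.

Lemma nb_edges_hex_iter n : nb_edges (hex_iter n G) = (6 ^ n * nb_edges G)%N.
Proof.
elim: n => [|n IH]; first by rewrite mul1n.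
by rewrite [LHS]nb_edges_hex IH expnS mulnA.
Qed.

Lemma nb_vertices_hex_iter n :
  (nb_vertices (hex_iter n G))%:R =
  (nb_vertices G)%:R + 4 / 5 * (6 ^+ n - 1) * (nb_edges G)%:R :> R.
Proof.
elim: n => [|n IH]; first by rewrite expr0; ring.
rewrite [nb_vertices _]nb_vertices_hex natrD natrM IH nb_edges_hex_iter.
by rewrite natrM natrX exprS; field.
Qed.

Lemma kirchhoff_hex_iter n :
  mult_degree_Kirchhoff R (hex_iter n.+1 G) =
  30 * mult_degree_Kirchhoff R (hex_iter n G)
  - 16 * 6 ^+ n * (nb_edges G)%:R * (nb_vertices G)%:R
  + (416 / 5 * 6 ^+ n ^+ 2 + 64 / 5 * 6 ^+ n) * (nb_edges G)%:R ^+ 2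
  - 24 * 6 ^+ n * (nb_edges G)%:R.
Proof.
have [m [k greenk]] := hex_iter_green n.
rewrite [LHS](kirchhoff_hex greenk (hex_iter_vert n)).
by rewrite nb_vertices_hex_iter nb_edges_hex_iter natrM natrX; field.
Qed.

Lemma kirchhoff_hex_iter_closed n :
  mult_degree_Kirchhoff R (hex_iter n.+1 G) =
  30 ^+ n.+1 * mult_degree_Kirchhoff R G
  - 4 * 6 ^+ n * (5 ^+ n.+1 - 1) * (nb_edges G)%:R * (nb_vertices G)%:R
  + 16 / 5 * 6 ^+ n * (5 ^+ n.+1 - 1) * (nb_edges G)%:R ^+ 2
  + 416 * 30 ^+ n * ((6 / 5) ^+ n.+1 - 1) * (nb_edges G)%:R ^+ 2
  - 6 * 6 ^+ n * (5 ^+ n.+1 - 1) * (nb_edges G)%:R.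
Proof.
(* [field] must see the powers of 30 and 6/5 as products of powers of 5 and 6. *)
have -> : (30 : R) = 5 * 6 by ring.
elim: n => [|n IH].
  by rewrite kirchhoff_hex_iter !expr1 !expr0; field.
rewrite kirchhoff_hex_iter IH !exprS !exprMn !exprVn.
have n5 : (5 : R) ^+ n != 0 by rewrite expf_neq0 // pnatr_eq0.
by field.
Qed.
End Iterate.

Theorem theorem3p2 (R : realFieldType) (G : sgraph) (N0 E0 n : nat)
    (hG : connected_graph G)
    (hN0 : nb_vertices G = N0) (hE0 : nb_edges G = E0)
    (hE0_ge1 : (1 <= E0)%N) (hn : (1 <= n)%N) :
  mult_degree_Kirchhoff R (hex_iter n G) =
    30 * mult_degree_Kirchhoff R (hex_iter (n - 1) G)
    - 16 * 6 ^+ (n - 1) * E0%:R * N0%:R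
    + (416 / 5 * 6 ^+ (2 * n - 2) + 64 / 5 * 6 ^+ (n - 1)) * E0%:R ^+ 2
    - 24 * 6 ^+ (n - 1) * E0%:R
  /\
  mult_degree_Kirchhoff R (hex_iter n G) =
    30 ^+ n * mult_degree_Kirchhoff R G
    - 4 * 6 ^+ (n - 1) * (5 ^+ n - 1) * E0%:R * N0%:R
    + 16 / 5 * 6 ^+ (n - 1) * (5 ^+ n - 1) * E0%:R ^+ 2
    + 416 * 30 ^+ (n - 1) * ((6 / 5) ^+ n - 1) * E0%:R ^+ 2
    - 6 * 6 ^+ (n - 1) * (5 ^+ n - 1) * E0%:R.
Proof.
case: n hn => // n _; rewrite -hN0 -hE0 mulnS addKn subn1 /=.
split; last exact: kirchhoff_hex_iter_closed.
by rewrite kirchhoff_hex_iter // -exprM [(n * 2)%N]mulnC.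
Qed.
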